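(* Let $\alpha\in(0,2]$ with $\alpha\ne1$ and let $\gamma\in(0,\infty)$. The one-dimensional stable Lévy process with symbol (characteristic exponent) $p(\xi)=\gamma|\xi|^{\alpha}$ is recurrent if and only if $\alpha>1$.
   Context: The Lévy process $\{X_t\}_{t\ge0}$ on $\mathbb{R}$ with characteristic exponent $p$ satisfies $\mathbb{E}^{0}[e^{i\xi X_t}]=e^{-tp(\xi)}$; $\mathbb{P}^x$ denotes the law of the process started at $x$. Let $\lambda$ be Lebesgue measure and $p^t(x,\cdot)=\mathbb{P}^x(X_t\in\cdot)$. A càdlàg strong Markov process is Lebesgue irreducible if $\lambda(B)>0$ implies $\int_0^\infty p^t(x,B)\,dt>0$ for all $x$. It is recurrent if it is Lebesgue irreducible and $\lambda(B)>0$ implies $\int_0^\infty p^t(x,B)\,dt=\infty$ for all $x$. *)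

(* Defs.v *)
From mathcomp Require Import all_boot all_order all_algebra.
From mathcomp Require Import all_classical all_reals all_analysis.
From mathcomp Require Import complex.

Set Implicit Arguments.
Unset Strict Implicit.
Unset Printing Implicit Defensive.

Import Order.TTheory GRing.Theory Num.Theory.
Import numFieldNormedType.Exports.

Local Open Scope classical_set_scope.
Local Open Scope ring_scope.
Local Open Scope complex_scope.

(* e ^ (a + i b) = e ^ a (cos b + i sin b) *)
Definition cexp (R : realType) (z : R[i]) : R[i] :=
  (expR (complex.Re z) * cos (complex.Im z))
    +i* (expR (complex.Re z) * sin (complex.Im z)).

(* Meaningful only when the real and imaginary parts of Z are integrable, which
   holds for the bounded variables e ^ (i xi X_t) it is applied to below. *)
Definition cexpectation (d : measure_display) (T : measurableType d)
    (R : realType) (P : probability T R) (Z : T -> R[i]) : R[i] :=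
  fine 'E_P[fun w => complex.Re (Z w)] +i* fine 'E_P[fun w => complex.Im (Z w)].

Definition cadlag (R : realType) (f : R -> R) : Prop :=
  (forall t, 0 <= t -> f s @[s --> t^'+] --> f t) /\
  (forall t, 0 < t -> cvg (f s @[s --> t^'-])).

(* Since B k = setT is allowed, the product rule for the whole family contains
   the product rules for its subfamilies. *)
Definition mutually_independent (d : measure_display) (T : measurableType d)
    (R : realType) (P : probability T R) (n : nat) (Y : nat -> T -> R) : Prop :=
  forall B : nat -> set R, (forall k, measurable (B k)) ->
    P (\bigcap_(k < n) (Y k @^-1` B k)) =
    (\prod_(k < n) P (Y k @^-1` B k))%E.

(* Time is indexed by R; only the variables X t with 0 <= t matter. *)
Record levy_process (d : measure_display) (T : measurableType d)
    (R : realType) (P : probability T R) (X : R -> {RV P >-> R}) : Prop := {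
  levy_start : {ae P, forall w, X 0 w = 0} ;
  levy_independent_increments :
    forall (n : nat) (s : nat -> R),
      0 <= s 0%N -> {homo s : i j / (i <= j)%N >-> i <= j} ->
      mutually_independent P n (fun k w => X (s k.+1) w - X (s k) w) ;
  levy_stationary_increments :
    forall s t : R, 0 <= s -> 0 <= t -> forall B : set R, measurable B ->
      P [set w | B (X (s + t) w - X s w)] = P [set w | B (X t w)] ;
  levy_cadlag : {ae P, forall w, cadlag (fun t => X t w)} }.

(* E ^ 0 [e ^ (i xi X_t)] = e ^ (- t p(xi)) *)
Definition has_characteristic_exponent (d : measure_display)
    (T : measurableType d) (R : realType) (P : probability T R)
    (X : R -> {RV P >-> R}) (p : R -> R[i]) : Prop :=
  forall t xi : R, 0 <= t ->
    cexpectation P (fun w => cexp (0 +i* (xi * X t w))) =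
    cexp (- (t%:C * p xi)).

(* p ^ t (x, .): under P ^ x the process is distributed as x + X under P. *)
Definition levy_transition (d : measure_display) (T : measurableType d)
    (R : realType) (P : probability T R) (X : R -> {RV P >-> R}) (t x : R) :
    set R -> \bar R :=
  pushforward P (fun w => x + X t w).

(* p t x B is the probability of reaching B at time t from x. *)
Definition lebesgue_irreducible (R : realType)
    (p : R -> R -> set R -> \bar R) : Prop :=
  forall B : set R, measurable B -> (0 < lebesgue_measure B)%E ->
    forall x : R, (0 < \int[lebesgue_measure]_(t in `[0%R, +oo[) p t x B)%E.

Definition recurrent (R : realType) (p : R -> R -> set R -> \bar R) : Prop :=
  lebesgue_irreducible p /\
  forall B : set R, measurable B -> (0 < lebesgue_measure B)%E ->
    forall x : R, (\int[lebesgue_measure]_(t in `[0%R, +oo[) p t x B = +oo)%E.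

(* Main.v *)
Require Import Defs.
From mathcomp Require Import all_boot all_order all_algebra.
From mathcomp Require Import all_classical all_reals all_analysis.
From mathcomp Require Import complex.
From mathcomp Require Import measurable_realfun.
From mathcomp Require Import ring lra.

(* The proof smooths the law of X_t with the Poisson kernel
   s / (s ^ 2 + u ^ 2), the Laplace transform of xi |-> cos (xi u). By Tonelli,
   E [s / (s ^ 2 + (a + X_t) ^ 2)] is the integral over xi >= 0 of
   e ^ (- s xi) cos (xi a) e ^ (- t gamma xi ^ alpha).
   If alpha < 1, take s = 1 and a = 0 and split the integral at
   delta = (1 + t) ^ (- k) with 1 < k < 1 / alpha: this gives
   P (|X_t| <= 1) = O(t ^ (- k)), which is integrable in t.
   If alpha >= 1, the integral is at least c / t for t large, uniformly in
   s <= 1 and in bounded a: the part xi <= 1 / t contributes that much, and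
   the rest is nonnegative up to an O(1 / t ^ 2) tail. Letting s tend to 0, the
   law of x + X_t gives a compact set K mass at least (c / (pi t)) lambda(K),
   since the smoothed indicator of K vanishes off K in the limit. As every set
   of positive measure contains a compact one, the integral over t diverges. *)

Set Implicit Arguments.
Unset Strict Implicit.
Unset Printing Implicit Defensive.

Import Order.TTheory GRing.Theory Num.Theory.
Import numFieldNormedType.Exports.

Local Open Scope ring_scope.
Local Open Scope complex_scope.

(** * Integrals on half-lines *)

(* Neither function is assumed measurable: the integral of a nonnegative function
   is a supremum over simple functions below it. This is applied to
   t |-> P (X_t \in B), whose measurability is not available. *)
Lemma le_integral_ge0 (d : measure_display) (T : measurableType d)
    (R : realType) (mu : {measure set T -> \bar R}) (D : set T)
    (f g : T -> \bar R) :
  (forall x, D x -> 0 <= f x)%E -> (forall x, D x -> f x <= g x)%E ->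
  (\int[mu]_(x in D) f x <= \int[mu]_(x in D) g x)%E.
Proof.
move=> f0 fg; have g0 x : D x -> (0 <= g x)%E.
  by move=> Dx; exact: le_trans (f0 x Dx) (fg x Dx).
rewrite !ge0_integralE//; apply: ge_ereal_sup => _ [h hf <-].
apply: ereal_sup_ubound; exists h => // x; apply: le_trans (hf x) _.
by rewrite /patch; case: ifPn => // /set_mem; exact: fg.
Qed.

Lemma integral_FTC2y (R : realType) (f F : R -> R) (a l : R) :
  (forall x, a <= x -> 0 <= f x) ->
  (forall x, a <= x -> {for x, continuous f}) ->
  (forall x, a <= x -> is_derive x 1 F (f x)) ->
  (F x @[x --> +oo] --> l)%classic ->
  (\int[lebesgue_measure]_(x in `[a, +oo[%classic) (f x)%:E)%E = (l - F a)%:E.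
Proof.
move=> f0 cf dF Fl; rewrite EFinB; apply: (ge0_continuous_FTC2y f0 _ Fl).
- apply: continuous_in_subspaceT => x /set_mem /=.
  by rewrite in_itv/= andbT; exact: cf.
- by move=> x /ltW/dF [].
- apply: cvg_at_right_filter; apply: differentiable_continuous.
  by apply/derivable1_diffP; case: (dF a).
- move=> x; rewrite in_itv/= andbT => /ltW ax.
  by rewrite derive1E; have [_ ->] := dF _ ax.
Qed.

Lemma integral_FTC2 (R : realType) (f F : R -> R) (a b : R) : a < b ->
  (forall x, a <= x <= b -> {for x, continuous f}) ->
  (forall x, a <= x <= b -> is_derive x 1 F (f x)) ->
  (\int[lebesgue_measure]_(x in `[a, b]%classic) (f x)%:E)%E = (F b - F a)%:E.
Proof.
move=> ab cf dF; rewrite EFinB.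
have cF x : a <= x <= b -> {for x, continuous F}.
  move=> axb; apply: differentiable_continuous.
  by apply/derivable1_diffP; case: (dF x).
apply: (continuous_FTC2 ab).
- by apply: continuous_in_subspaceT => x /set_mem /=; rewrite in_itv/=; exact: cf.
- split.
  + move=> x; rewrite in_itv/= => /andP[/ltW ax /ltW xb].
    by have [] : is_derive x 1 F (f x) by apply: dF; rewrite ax.
  + by apply: cvg_at_right_filter; apply: cF; rewrite lexx ltW.
  + by apply: cvg_at_left_filter; apply: cF; rewrite lexx ltW.
- move=> x; rewrite in_itv/= => /andP[/ltW ax /ltW xb].
  by rewrite derive1E; have [|_ ->] := dF x; first by rewrite ax.
Qed.

Lemma cvg_expRN (R : realType) (s : R) : 0 < s ->
  (expR (- (s * x)) @[x --> +oo] --> 0)%classic.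
Proof.
move=> s0; apply: (@cvg_comp _ _ _ (fun x => s * x) (fun x => expR (- x))
  _ (pinfty_nbhs R)); last exact: cvgr_expR.
exact: gt0_cvgMry.
Qed.

Lemma integral_expRN (R : realType) (s : R) : 0 < s ->
  (\int[lebesgue_measure]_(x in `[0%R, +oo[%classic) (expR (- (s * x)))%:E)%E
    = (s^-1)%:E.
Proof.
move=> s0; pose F x : R := - s^-1 * expR (- (s * x)).
have dF (x : R) : 0 <= x -> is_derive x 1 F (expR (- (s * x))).
  move=> _; apply: is_derive_eq; rewrite /GRing.scale/=; field.
  by rewrite gt_eqF.
rewrite (@integral_FTC2y _ _ _ _ 0 _ _ dF).
- by congr EFin; rewrite /F mulr0 oppr0 expR0; ring.
- by move=> x _; exact: expR_ge0.
- move=> x _; apply: differentiable_continuous; apply/derivable1_diffP.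
  exact: ex_derive.
- by have := cvgMl_tmp (a := - s^-1) (cvg_expRN s0); rewrite mulr0; apply.
Qed.

(** The summand 1 keeps the integrand nonnegative, as both the fundamental theorem on a half-line
    and Tonelli require. It costs an extra [s^-1], which cancels wherever the formula is applied. *)
Lemma integral_expRN_1Dcos (R : realType) (s y : R) : 0 < s ->
  (\int[lebesgue_measure]_(x in `[0%R, +oo[%classic)
     (expR (- (s * x)) * (1 + cos (x * y)))%:E)%E
    = (s^-1 + s / (s ^+ 2 + y ^+ 2))%:E.
Proof.
move=> s0.
have D0 : s ^+ 2 + y ^+ 2 != 0 by rewrite gt_eqF// ltr_wpDr ?sqr_ge0// exprn_gt0.
(* Antiderivative found by integrating by parts twice. *)
pose F x : R := expR (- (s * x)) *
  (- s^-1 + (y * sin (x * y) - s * cos (x * y)) / (s ^+ 2 + y ^+ 2)).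
have dF (x : R) : 0 <= x ->
    is_derive x 1 F (expR (- (s * x)) * (1 + cos (x * y))).
  move=> _; apply: is_derive_eq; rewrite /GRing.scale/=; field.
  by rewrite D0 gt_eqF.
rewrite (@integral_FTC2y _ _ _ _ 0 _ _ dF).
- congr EFin; rewrite /F mul0r mulr0 oppr0 expR0 sin0 cos0; ring.
- by move=> x _; rewrite mulr_ge0 ?expR_ge0.
- move=> x _; apply: differentiable_continuous; apply/derivable1_diffP.
  exact: ex_derive.
(* [C] bounds the bounded factor of [F], so that the exponential forces [F] to 0 at infinity. *)
- pose C := s^-1 + (`|y| + s) / (s ^+ 2 + y ^+ 2).
  have bF x : `|F x| <= expR (- (s * x)) * C.
    rewrite /F normrM ger0_norm ?expR_ge0// ler_wpM2l ?expR_ge0//.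
    rewrite (le_trans (ler_normD _ _))// normrN gtr0_norm ?invr_gt0// lerD2l.
    rewrite normrM normfV [X in _ / X]ger0_norm ?addr_ge0 ?sqr_ge0//.
    rewrite ler_wpM2r ?invr_ge0 ?addr_ge0 ?sqr_ge0//.
    rewrite (le_trans (ler_normB _ _))// !normrM lerD//.
      by rewrite ler_piMr// sin_max.
    by rewrite (gtr0_norm s0) ler_piMr ?cos_max// ltW.
  have C0 : (expR (- (s * x)) * C @[x --> +oo] --> 0)%classic.
    by have := cvgMr_tmp (b := C) (cvg_expRN s0); rewrite mul0r; apply.
  apply: (@squeeze_cvgr _ _ _ _ (fun x => - (expR (- (s * x)) * C))
    (fun x => expR (- (s * x)) * C)); last exact: C0.
    by near=> x; have := bF x; rewrite ler_norml.
  by have := cvgN C0; rewrite oppr0; apply.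
Unshelve. all: by end_near. Qed.

(** * The Poisson kernel *)

Lemma measurable_cos (R : realType) : measurable_fun setT (@cos R).
Proof. by apply: continuous_measurable_fun => x; exact: continuous_cos. Qed.

Lemma integrable_bounded_comp (d : measure_display) (T : measurableType d)
    (R : realType) (P : probability T R) (f : R -> R) (Y : T -> R) :
  measurable_fun setT f -> (forall x, `|f x| <= 1) -> measurable_fun setT Y ->
  P.-integrable setT (fun w => (f (Y w))%:E).
Proof.
move=> mf f1 mY; apply: (@measurable_bounded_integrable _ _ _ _ (f \o Y)) => //.
- by rewrite [X in (X < _)%E]probability_setT ltry.
- exact: measurableT_comp.
- by exists 1; split => // r r1 w _; exact: le_trans (f1 _) (ltW r1).
Qed.

Lemma integrable_cos_comp (d : measure_display) (T : measurableType d)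
    (R : realType) (P : probability T R) (Y : T -> R) :
  measurable_fun setT Y -> P.-integrable setT (fun w => (cos (Y w))%:E).
Proof.
move=> mY; apply: (integrable_bounded_comp _ _ _ mY).
- exact: measurable_cos.
- exact: cos_max.
Qed.

Lemma integrable_sin_comp (d : measure_display) (T : measurableType d)
    (R : realType) (P : probability T R) (Y : T -> R) :
  measurable_fun setT Y -> P.-integrable setT (fun w => (sin (Y w))%:E).
Proof.
move=> mY; apply: (integrable_bounded_comp _ _ _ mY).
- by apply: continuous_measurable_fun => x; exact: continuous_sin.
- exact: sin_max.
Qed.

Lemma poisson_kernel_ge0 (R : realType) (s u : R) : 0 < s ->
  0 <= s / (s ^+ 2 + u ^+ 2).
Proof. by move=> s0; rewrite divr_ge0 ?addr_ge0 ?sqr_ge0// ltW. Qed.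

Lemma continuous_poisson_kernel (R : realType) (s : R) : 0 < s ->
  continuous (fun u : R => s / (s ^+ 2 + u ^+ 2)).
Proof.
move=> s0 u; apply: cvgM; first exact: cvg_cst.
apply: cvgV; first by rewrite gt_eqF// ltr_wpDr ?sqr_ge0// exprn_gt0.
by apply: cvgD; [exact: cvg_cst|exact: exprn_continuous].
Qed.

Lemma measurable_poisson_kernel (R : realType) (s : R) : 0 < s ->
  measurable_fun setT (fun u : R => s / (s ^+ 2 + u ^+ 2)).
Proof.
by move=> s0; apply: continuous_measurable_fun; exact: continuous_poisson_kernel.
Qed.

(** Both sides are iterated integrals of e ^ (- s xi) (1 + cos (xi Y)) over [P] and over xi >= 0:
    integrating in xi first produces the kernel, integrating over [P] first produces [phi]. The law
    of [Y] enters only through the mean of its cosines. *)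
Lemma expectation_poisson_kernel (R : realType) (d : measure_display)
    (T : measurableType d) (P : probability T R) (Y : T -> R) (phi : R -> R)
    (s : R) : 0 < s -> measurable_fun setT Y ->
  (forall xi : R, 0 <= xi -> (\int[P]_w (cos (xi * Y w))%:E = (phi xi)%:E)%E) ->
  ((s^-1)%:E + \int[P]_w (s / (s ^+ 2 + Y w ^+ 2))%:E =
   \int[lebesgue_measure]_(xi in `[0%R, +oo[%classic)
     (expR (- (s * xi)) * (1 + phi xi))%:E)%E.
Proof.
move=> s0 mY hphi.
(* The indicator restricts xi to the half-line, so that Tonelli applies on the whole product
   space. *)
pose f (z : T * R) : \bar R :=
  ((expR (- (s * z.2)) * (1 + cos (z.2 * Y z.1))) *
   \1_(`[0%R, +oo[%classic) z.2)%:E.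
have f0 z : (0 <= f z)%E by rewrite lee_fin !mulr_ge0 ?expR_ge0.
have mcos := @measurable_cos R.
have mf : measurable_fun setT f.
  apply/measurable_EFinP; apply: measurable_funM; first apply: measurable_funM.
  - apply: measurableT_comp => //; apply: measurableT_comp => //.
    exact: measurable_funM.
  - apply: measurable_funD => //; apply: measurableT_comp => //.
    by apply: measurable_funM => //; exact: measurableT_comp.
  - by apply: measurableT_comp => //; exact: measurable_indic.
have := fubini_tonelli (m1 := P) (m2 := lebesgue_measure) f mf f0.
set L := LHS; set Q := RHS => LQ.
transitivity L; last rewrite LQ.
- rewrite /L.
  have -> : ((s^-1)%:E = \int[P]_w (s^-1)%:E)%E.
    by rewrite integral_cst// [X in (_ * X)%E]probability_setT mule1.
  rewrite -ge0_integralD//.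
  + apply: eq_integral => w _; rewrite -EFinD -integral_expRN_1Dcos//.
    rewrite integral_mkcond; apply: eq_integral => x _.
    rewrite /patch /f /= indicE; case: ifP; rewrite ?mulr1// mulr0//.
  + by move=> w _; rewrite lee_fin invr_ge0 ltW.
  + move=> w _; rewrite lee_fin divr_ge0 ?addr_ge0 ?sqr_ge0// ltW//.
  + apply/measurable_EFinP.
    exact: measurableT_comp (measurable_poisson_kernel s0) mY.
- rewrite /Q [RHS]integral_mkcond; apply: eq_integral => x _.
  rewrite /patch /f /= indicE; case: ifPn => [|_]; last first.
    by rewrite integral0_eq// => w _; rewrite mulr0.
  rewrite inE/= in_itv/= andbT => x0.
  under eq_integral do rewrite mulr1 EFinM.
  have mc : measurable_fun setT (fun w => cos (x * Y w)).
    by apply: measurableT_comp => //; exact: measurable_funM.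
  have ic : P.-integrable setT (fun w => (cos (x * Y w))%:E).
    by apply: integrable_cos_comp; exact: measurable_funM.
  rewrite ge0_integralZl; last 4 first.
  + exact: measurableT.
  + by apply/measurable_EFinP; exact: measurable_funD.
  + by move=> w _; rewrite lee_fin.
  + by rewrite lee_fin expR_ge0.
  rewrite EFinM; congr (_ * _)%E.
  under eq_integral do rewrite EFinD.
  rewrite integralD//.
  + by rewrite hphi// integral_cst// [X in (_ * X)%E]probability_setT mule1 EFinD.
  + exact: finite_measure_integrable_cst.
Qed.

(** The addition formula splits off the shift [a]. As the exponent is real, the imaginary part of
    the characteristic function vanishes, and with it the sine term. *)
Lemma expectation_cos_shift (d : measure_display) (T : measurableType d)
    (R : realType) (P : probability T R) (X : R -> {RV P >-> R})
    (psi : R -> R) (t a xi : R) :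
  has_characteristic_exponent X (fun xi => (psi xi)%:C) -> 0 <= t ->
  (\int[P]_w (cos (xi * (a + X t w)))%:E
    = (cos (xi * a) * expR (- (t * psi xi)))%:E)%E.
Proof.
move=> hp t0; have := hp t xi t0; rewrite /cexpectation /cexp /=.
rewrite !(mul0r, mulr0, subr0, addr0, add0r, oppr0, sin0, cos0, mulr1, expR0).
under [X in fine 'E_P[X] +i* _ ]eq_fun do rewrite mul1r.
under [X in _ +i* fine 'E_P[X]]eq_fun do rewrite mul1r.
have mX : measurable_fun setT (fun w => xi * X t w) by exact: measurable_funM.
have ic := integrable_cos_comp P mX.
have isn := integrable_sin_comp P mX.
rewrite unlock => -[hc hs].
under eq_integral do rewrite mulrDr cosD EFinB !EFinM.
rewrite integralB//; [|exact: integrableZl..].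
rewrite !integralZl// -[X in (_ * X - _)%E]fineK; last exact: integrable_fin_num.
rewrite -[X in (_ - _ * X)%E]fineK; last exact: integrable_fin_num.
by rewrite hc hs mule0 sube0 EFinM.
Qed.

(** In [y] the kernel is the derivative of - atan ((x - y) / s), whose increments stay below pi.
    Compactness encloses [K] in a bounded interval where this antiderivative can be evaluated. *)
Lemma integral_poisson_kernel_le_pi (R : realType) (s x : R) (K : set R) :
  0 < s -> compact K ->
  (\int[lebesgue_measure]_(y in K) (s / (s ^+ 2 + (x - y) ^+ 2))%:E
    <= pi%:E)%E.
Proof.
move=> s0 cK; have [M [_ KM]] := compact_bounded cK.
pose b : R := `|M| + 1; have b0 : 0 < b by rewrite ltr_wpDl.
have Kb : (K `<=` `[- b, b])%classic.
  move=> y Ky /=; rewrite in_itv/= -ler_norml; apply: (KM b) => //.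
  by rewrite /b; have := ler_norm M; lra.
have sD y : s ^+ 2 + (x - y) ^+ 2 != 0.
  by rewrite gt_eqF// ltr_wpDr ?sqr_ge0// exprn_gt0.
have ck : continuous (fun y => s / (s ^+ 2 + (x - y) ^+ 2)).
  move=> y; apply: (@continuous_comp _ _ _ (fun y => x - y)
    (fun u => s / (s ^+ 2 + u ^+ 2))); last exact: continuous_poisson_kernel.
  by apply: cvgB; [exact: cvg_cst|exact: cvg_id].
have mk : measurable_fun setT (fun y : R => (s / (s ^+ 2 + (x - y) ^+ 2))%:E).
  by apply/measurable_EFinP; exact: continuous_measurable_fun.
have mK : measurable K by apply: closed_measurable; exact: compact_closed.
have mb : measurable (`[- b, b]%classic : set R) by exact: measurable_itv.
pose k (y : R) := (s / (s ^+ 2 + (x - y) ^+ 2))%:E.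
have k0 y : (0 <= k y)%E by rewrite lee_fin poisson_kernel_ge0.
apply: (@le_trans _ _ (\int[lebesgue_measure]_(y in `[(- b)%R, b]%classic) k y)%E).
  apply: ge0_subset_integral => //.
  - exact: measurable_funTS mk.
  - by move=> y _; exact: k0.
pose F y := - atan ((x - y) / s).
have dF y : - b <= y <= b -> is_derive y 1 F (s / (s ^+ 2 + (x - y) ^+ 2)).
  move=> _; apply: is_derive_eq; rewrite /GRing.scale/=; field.
  by rewrite sD gt_eqF.
rewrite /k (integral_FTC2 _ _ dF) ?lee_fin; last 2 first.
- by lra.
- by move=> y _; exact: ck.
rewrite /F; have := atan_ltpi2 ((x - - b) / s); have := atan_gtNpi2 ((x - b) / s).
by lra.
Qed.

(** A point off the closed set [K] has some distance r > 0 from it, and there the kernel of scale s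
    is at most s / r ^ 2. The integral is thus at most s times a constant, with s = 1 / (n + 1). *)
Lemma poisson_kernel_cvg0 (R : realType) (x : R) (K : set R) :
  compact K -> ~ K x ->
  ((\int[lebesgue_measure]_(y in K)
     (n.+1%:R^-1 / (n.+1%:R^-1 ^+ 2 + (x - y) ^+ 2))%:E)%E
    @[n --> \oo] --> 0%E)%classic.
Proof.
move=> cK nKx; have clK := compact_closed (@Rhausdorff R) cK.
have mK : measurable K by exact: closed_measurable.
have : nbhs x (~` K)%classic.
  by apply: open_nbhs_nbhs; split => //; exact: closed_openC.
move=> /nbhs_ballP[r /= r0 rK].
have far y : K y -> r <= `|x - y|.
  by move=> Ky; rewrite leNgt; apply/negP => /rK; exact.
pose C := fine (lebesgue_measure K) / r ^+ 2.
apply: (@squeeze_cvge _ _ _ _ (fun=> 0%E) _ (fun n => (n.+1%:R^-1 * C)%:E)).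
- near=> n; apply/andP; split.
    by apply: integral_ge0 => y _; rewrite lee_fin poisson_kernel_ge0.
  apply: (@le_trans _ _ (\int[lebesgue_measure]_(y in K)
     cst (n.+1%:R^-1 / r ^+ 2)%:E y)%E).
    apply: le_integral_ge0 => y Ky; first by rewrite lee_fin poisson_kernel_ge0.
    rewrite lee_fin ler_wpM2l// lef_pV2 ?posrE ?exprn_gt0//; last first.
      by rewrite ltr_wpDr ?sqr_ge0// exprn_gt0.
    rewrite -[X in _ <= _ + X]real_normK ?num_real// ler_wpDl ?sqr_ge0//.
    by rewrite ler_pXn2r ?nnegrE ?far// ltW.
  rewrite integral_cst// /C.
  have -> : n.+1%:R^-1 * (fine (lebesgue_measure K) / r ^+ 2) =
      n.+1%:R^-1 / r ^+ 2 * fine (lebesgue_measure K) by ring.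
  have KE : (lebesgue_measure K = (fine (lebesgue_measure K))%:E)%E.
    by rewrite fineK// ge0_fin_numE//; exact: compact_finite_measure.
  by rewrite [X in (_ * X <= _)%E]KE -EFinM.
- exact: cvg_cst.
- apply: cvg_EFin; first exact: nearW.
  by have := cvgMr_tmp (b := C) (@cvg_harmonic R); rewrite mul0r; apply.
Unshelve. all: by end_near. Qed.

(** Integrating the hypothesis over y in [K] and exchanging integrals bounds the left side by the
    mean of the kernel mass that [K] receives around [Y]. That mass is at most pi when [Y] lies in
    [K] and tends to 0 otherwise, so dominated convergence leaves only pi times the probability of
    [K]. *)
Lemma poisson_lower_bound_compact (d : measure_display) (T : measurableType d)
    (R : realType) (P : probability T R) (Y : T -> R) (K : set R) (c : R) :
  measurable_fun setT Y -> compact K -> 0 <= c ->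
  (forall s y, 0 < s -> s <= 1 -> K y ->
    (c%:E <= \int[P]_w (s / (s ^+ 2 + (Y w - y) ^+ 2))%:E)%E) ->
  (c%:E * lebesgue_measure K <= pi%:E * P (Y @^-1` K)%classic)%E.
Proof.
move=> mY cK c0 hc.
have mK : measurable K.
  by apply: closed_measurable; exact: compact_closed (@Rhausdorff R) cK.
have mYK : measurable (Y @^-1` K)%classic.
  by rewrite -[X in measurable X]setTI; exact: mY.
pose s n : R := n.+1%:R^-1.
have s0 n : 0 < s n by rewrite invr_gt0.
pose k n (u : R) := s n / (s n ^+ 2 + u ^+ 2).
have k0 n u : 0 <= k n u by exact: poisson_kernel_ge0.
pose F n (z : T * R) : \bar R := (k n (Y z.1 - z.2) * \1_K z.2)%:E.
have F0 n z : (0 <= F n z)%E by rewrite lee_fin mulr_ge0.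
have mF n : measurable_fun setT (F n).
  apply/measurable_EFinP; apply: measurable_funM.
    apply: (measurableT_comp (measurable_poisson_kernel (s0 n))).
    by apply: measurable_funB => //; exact: measurableT_comp.
  by apply: measurableT_comp => //; exact: measurable_indic.
pose H n w : \bar R := (\int[lebesgue_measure]_y F n (w, y))%E.
have HE n w : (H n w = \int[lebesgue_measure]_(y in K) (k n (Y w - y))%:E)%E.
  rewrite [RHS]integral_mkcond; apply: eq_integral => y _.
  by rewrite /patch /F /= indicE; case: ifP; rewrite ?mulr1// mulr0.
have H0 n w : (0 <= H n w)%E by apply: integral_ge0 => y _; exact: F0.
have Hpi n w : (H n w <= pi%:E)%E.
  by rewrite HE; exact: integral_poisson_kernel_le_pi.
have mH n : measurable_fun setT (H n).
  exact: (@measurable_fun_fubini_tonelli_F _ _ _ _ _ lebesgue_measure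
    (F n) (mF n) (F0 n)).
have lowH n : (c%:E * lebesgue_measure K <= \int[P]_w H n w)%E.
  rewrite /H (fubini_tonelli (m1 := P) (m2 := lebesgue_measure) (F n) (mF n) (F0 n)).
  rewrite -integral_cst// [X in (X <= _)%E]integral_mkcond.
  apply: le_integral_ge0 => y _; rewrite /patch; case: ifPn => yK.
  - by rewrite lee_fin.
  - by [].
  - have Ky : K y by move: yK; rewrite inE.
    rewrite /F /= indicE yK; under eq_integral do rewrite mulr1.
    apply: hc => //; rewrite /s invf_le1 ?ler1n//.
  - by apply: integral_ge0 => w _; exact: F0.
pose I w : R := \1_(~` (Y @^-1` K))%classic w.
(* G n is H n off K: it is bounded by pi and tends to 0 pointwise. *)
pose G n w : \bar R := (H n w * (I w)%:E)%E.
have mI : measurable_fun setT (fun w => (I w)%:E).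
  by apply/measurable_EFinP; apply: measurable_indic; exact: measurableC.
have mG n : measurable_fun setT (G n) by exact: emeasurable_funM.
have G0 n w : (0 <= G n w)%E by rewrite mule_ge0// lee_fin.
(* Split according to whether [Y w] lies in [K]: there [H n] is at most pi, elsewhere it equals
   [G n]. *)
have upH n : (\int[P]_w H n w <= pi%:E * P (Y @^-1` K)%classic + \int[P]_w G n w)%E.
  have <- : (\int[P]_w (\1_(Y @^-1` K)%classic w)%:E = P (Y @^-1` K)%classic)%E.
    by rewrite integral_indic// setIT.
  rewrite -ge0_integralZl//; last 2 first.
  - by apply/measurable_EFinP; exact: measurable_indic.
  - by rewrite lee_fin pi_ge0.
  rewrite -ge0_integralD//; last 2 first.
  - by move=> w _; rewrite mule_ge0// lee_fin ?pi_ge0.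
  - apply: emeasurable_funM => //; apply/measurable_EFinP.
    exact: measurable_indic.
  apply: le_integral_ge0 => w _ //; rewrite /G /I !indicE in_setC.
  by case: (w \in _); rewrite ?mule1 ?mule0 ?adde0 ?add0e.
have Gcvg : ((\int[P]_w G n w)%E @[n --> \oo] --> 0%E)%classic.
  have [] := @dominated_convergence _ _ _ P setT measurableT G (cst 0%E) (cst pi%:E).
  - exact: mG.
  - exact: measurable_cst.
  - apply: aeW => w _; rewrite /G /I indicE in_setC.
    have [wK|wK] := boolP (w \in _).
      by under eq_fun do rewrite mule0; exact: cvg_cst.
    under eq_fun do rewrite mule1 HE.
    apply: poisson_kernel_cvg0 => // KY; exact: (negP wK (mem_set KY)).
  - exact: finite_measure_integrable_cst.
  - apply: aeW => w n _; rewrite gee0_abs//= (le_trans _ (Hpi n w))// /G.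
    by rewrite -[leRHS]mule1 lee_wpmul2l// lee_fin /I indicE; case: (_ \in _).
  by move=> _ _; rewrite integral_cst// mul0e; apply.
have Scvg : ((pi%:E * P (Y @^-1` K)%classic + \int[P]_w G n w)%E
    @[n --> \oo] --> (pi%:E * P (Y @^-1` K)%classic + 0)%E)%classic.
  apply: cvgeD => //; last exact: cvg_cst.
  by rewrite fin_num_adde_defl.
rewrite -[leRHS]adde0.
apply: (cvge_ge _ Scvg); apply: nearW => n.
exact: le_trans (lowH n) (upH n).
Qed.

(** * Recurrence *)

Lemma cos_ge_cos1 (R : realType) (x : R) : `|x| <= 1 -> cos 1 <= cos x.
Proof.
move=> x1; have pi2 := pi_ge2 R.
rewrite -(cos_norm x) leNgt ltr_cos -?leNgt// in_itv/= ?normr_ge0; lra.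
Qed.

Lemma expRN_le_inv (R : realType) (x : R) : 0 < x -> expR (- x) <= x^-1.
Proof.
move=> x0; rewrite expRN lef_pV2 ?posrE ?expR_gt0//.
by have := expR_ge1Dx x; lra.
Qed.

Lemma powR_le_id (R : realType) (a x : R) : 1 <= a -> 0 <= x <= 1 -> x `^ a <= x.
Proof.
move=> a1 /andP[]; rewrite le_eqVlt => /predU1P[<- _|x0 x1].
  by rewrite powR0// gt_eqF//; lra.
have x01 : 0 < x <= 1 by rewrite x0.
by have := ger_powR x01 a1; rewrite (powRr1 (ltW x0)).
Qed.

(** The factor x ^ (a - 1) is nondecreasing. The linear minorant turns the tail of e ^ (- t gamma xi
    ^ alpha) into a plain exponential with an explicit integral. *)
Lemma powR_ge_linear (R : realType) (a x e : R) : 1 <= a -> 0 < e -> e <= x ->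
  e `^ (a - 1) * x <= x `^ a.
Proof.
move=> a1 e0 ex; have x0 : 0 < x by exact: lt_le_trans ex.
have -> : x `^ a = x `^ (a - 1) * x.
  rewrite -[X in _ = _ * X](powRr1 (ltW x0)) -powRD ?subrK//.
  by rewrite (gt_eqF x0) implybT.
rewrite ler_wpM2r ?(ltW x0)// ge0_ler_powR ?nnegrE ?(ltW e0) ?(ltW x0)//; lra.
Qed.

(* On [0, 1 / t] the cosine is at least cos 1 and t gamma xi ^ alpha <= gamma; on
   [1 / t, eta] the cosine is nonnegative; beyond eta the last product dominates,
   as xi ^ alpha >= eta ^ (alpha - 1) xi. *)
Lemma stable_poisson_pointwise (R : realType) (alpha gamma eta t s y xi : R) :
  1 <= alpha -> 0 < gamma -> 0 < eta -> eta <= 1 -> `|y| * eta <= 1 ->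
  eta^-1 <= t -> 0 < s -> s <= 1 -> 0 <= xi ->
  expR (- (s * xi)) + expR (- (1 + gamma)) * cos 1 * \1_(`[0, t^-1]%classic) xi
  <= expR (- (s * xi)) *
       (1 + cos (xi * y) * expR (- (t * (gamma * `|xi| `^ alpha)))) +
     expR (- (t * (gamma * eta `^ (alpha - 1)) * eta / 2)) *
       expR (- (t * (gamma * eta `^ (alpha - 1)) / 2 * xi)).
Proof.
move=> a1 g0 e0 e1 ye et s0 s1 x0.
have t0 : 0 < t by apply: lt_le_trans et; rewrite invr_gt0.
have te : t^-1 <= eta by rewrite invf_ple ?posrE.
rewrite ger0_norm// mulrDr mulr1 -[leRHS]addrA lerD2l.
have c1 : 0 < cos 1 :> R by exact: cos1_gt0.
have le_eta_cos : xi <= eta -> cos 1 <= cos (xi * y).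
  move=> xe; apply: cos_ge_cos1; rewrite normrM mulrC (ger0_norm x0).
  by apply: le_trans ye; rewrite ler_wpM2l.
rewrite indicE; case: (boolP (xi \in _)) => [|_].
- rewrite inE/= in_itv/= mulr1 x0 /= => xt.
  have xe := le_trans xt te.
  apply: ler_wpDr; first by rewrite mulr_ge0 ?expR_ge0.
  rewrite [leRHS]mulrCA [leRHS]mulrC -expRD.
  apply: ler_pM; rewrite ?expR_ge0 ?(ltW c1) ?le_eta_cos//.
  rewrite ler_expR -opprD lerN2.
  (* Here alpha >= 1 is decisive: xi ^ alpha <= xi <= 1 / t bounds the stable exponent by [gamma],
     while s xi <= 1 accounts for the 1 in [1 + gamma]. *)
  have xa : xi `^ alpha <= xi by rewrite powR_le_id// x0 (le_trans xe).
  have txa : t * xi `^ alpha <= 1.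
    rewrite -(mulfV (lt0r_neq0 t0)) ler_wpM2l ?(ltW t0)//; exact: le_trans xa xt.
  have sx : s * xi <= 1 by rewrite mulr_ile1 ?(ltW s0)// (le_trans xe).
  apply: lerD => //; rewrite mulrCA -[leRHS]mulr1.
  by rewrite ler_wpM2l// ltW.
- rewrite mulr0; have [xe|ex] := leP xi eta.
    have := le_eta_cos xe => cx.
    by rewrite addr_ge0 ?mulr_ge0 ?expR_ge0// (le_trans (ltW c1)).
  rewrite -expRD.
  set D := expR _ * (_ * _).
  have : `|D| <= expR (- (t * (gamma * eta `^ (alpha - 1)) * xi)).
    rewrite /D !normrM !(ger0_norm (expR_ge0 _)) mulrCA mulrC -expRD.
    rewrite -[leRHS]mulr1 ler_pM ?expR_ge0 ?cos_max//.
    rewrite ler_expR -opprD lerN2 ler_wpDl ?mulr_ge0// ?(ltW s0)//.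
    rewrite -!mulrA ler_pM2l// ler_pM2l//.
    exact: powR_ge_linear (ltW ex).
  rewrite ler_norml => /andP[Dlo _]; rewrite -lerBlDr sub0r.
  apply: le_trans Dlo; rewrite lerN2 ler_expR -opprD lerN2.
  (* Since xi > eta, half of the linear exponent can be evaluated at [eta], which makes the tail
     small; the other half keeps it integrable in xi. *)
  have k0 : 0 < t * (gamma * eta `^ (alpha - 1)).
    by rewrite !mulr_gt0// powR_gt0.
  have := ler_wpM2l (ltW k0) (ltW ex); lra.
Qed.

Lemma measurable_expRN (R : realType) (s : R) :
  measurable_fun setT (fun x : R => expR (- (s * x))).
Proof.
by apply: measurableT_comp => //; exact: measurableT_comp.
Qed.

Lemma measurable_stable_charfun (R : realType) (alpha gamma t a s : R) :
  measurable_fun setT (fun xi : R => expR (- (s * xi)) *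
    (1 + cos (xi * a) * expR (- (t * (gamma * `|xi| `^ alpha))))).
Proof.
apply: measurable_funM; first exact: measurable_expRN.
apply: measurable_funD => //; apply: measurable_funM.
  by apply: (measurableT_comp (@measurable_cos R)); exact: measurable_funM.
apply: (measurableT_comp (f := fun x => expR (- (t * x)))).
  exact: measurable_expRN.
apply: measurable_funM => //.
exact: (measurableT_comp (f := fun x : R => x `^ alpha)).
Qed.

Lemma stable_charfun_ge0 (R : realType) (alpha gamma t a xi s : R) :
  0 <= gamma -> 0 <= t ->
  0 <= expR (- (s * xi)) *
    (1 + cos (xi * a) * expR (- (t * (gamma * `|xi| `^ alpha)))).
Proof.
move=> g0 t0; rewrite mulr_ge0 ?expR_ge0// -lerBlDl sub0r.
have : `|cos (xi * a) * expR (- (t * (gamma * `|xi| `^ alpha)))| <= 1.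
  rewrite normrM mulr_ile1 ?cos_max// ger0_norm ?expR_ge0// -expR0 ler_expR.
  by rewrite oppr_le0 !mulr_ge0// powR_ge0.
by rewrite ler_norml => /andP[].
Qed.

(** Integrating the pointwise inequality over xi >= 0 gives s^-1 + A / t on the left and s^-1 + J +
    b / r on the right, where J is the wanted expectation. The term s^-1 cancels, and for large t
    the error b / r takes at most half of A / t. *)
Lemma stable_poisson_lower_bound (d : measure_display) (T : measurableType d)
    (R : realType) (P : probability T R) (X : R -> {RV P >-> R})
    (alpha gamma M : R) :
  1 <= alpha -> 0 < gamma -> 0 <= M ->
  has_characteristic_exponent X (fun xi : R => (gamma * (`|xi| `^ alpha))%:C) ->
  exists c t0 : R, [/\ 0 < c, 0 < t0 &
    forall t s a, t0 <= t -> 0 < s -> s <= 1 -> `|a| <= M ->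
    ((c / t)%:E <= \int[P]_w (s / (s ^+ 2 + (a + X t w) ^+ 2))%:E)%E].
Proof.
move=> a1 g0 M0 hp.
(* This [eta] is at most 1 and satisfies |a| eta <= 1 for every shift |a| <= M. *)
pose eta : R := (1 + M)^-1.
have M1 : 0 < 1 + M by lra.
have e0 : 0 < eta by rewrite invr_gt0.
have e1 : eta <= 1 by rewrite invf_le1//; lra.
pose kappa := gamma * eta `^ (alpha - 1).
have k0 : 0 < kappa by rewrite mulr_gt0// powR_gt0.
pose A : R := expR (- (1 + gamma)) * cos 1.
have A0 : 0 < A by rewrite mulr_gt0 ?expR_gt0 ?cos1_gt0.
(* By e ^ (- x) <= 1 / x the error is at most 4 / (t ^ 2 kappa ^ 2 eta), which equals (A / (2 t))
   (t1 / t). *)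
pose t1 := 8 / (A * kappa ^+ 2 * eta).
have t10 : 0 < t1.
  by rewrite divr_gt0// mulr_gt0// (mulr_gt0 A0)// exprn_gt0.
exists (A / 2), (eta^-1 + t1); split; [by rewrite divr_gt0| |].
  by rewrite addr_gt0// invr_gt0.
move=> t s a t0t s0 s1 aM.
have et : eta^-1 <= t by lra.
have t1t : t1 <= t by have := invr_gt0 eta; rewrite e0; lra.
have t0 : 0 < t by lra.
have mY : measurable_fun setT (fun w => a + X t w) by exact: measurable_funD.
have hphi xi : 0 <= xi -> (\int[P]_w (cos (xi * (a + X t w)))%:E =
    (cos (xi * a) * expR (- (t * (gamma * `|xi| `^ alpha))))%:E)%E.
  by move=> _; rewrite (expectation_cos_shift _ _ hp)// ltW.
have := expectation_poisson_kernel s0 mY hphi.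
set J := (\int[P]_w _)%E => IJ.
pose D : set R := `[0, +oo[%classic.
have mD : measurable D by exact: measurable_itv.
pose b : R := expR (- (t * kappa * eta / 2)).
pose r := t * kappa / 2.
have r0 : 0 < r by rewrite divr_gt0// mulr_gt0.
have ti0 : 0 <= t^-1 by rewrite invr_ge0 ltW.
have I1 : (\int[lebesgue_measure]_(xi in D)
    (expR (- (s * xi)) + A * \1_(`[0%R, t^-1]%classic) xi)%:E =
    (s^-1 + A / t)%:E)%E.
  under eq_integral do rewrite EFinD EFinM.
  have mI : measurable_fun D (EFin \o (\1_(`[0, t^-1]%classic) : R -> R)).
    by apply/measurable_EFinP; apply: measurable_indic; exact: measurable_itv.
  rewrite ge0_integralD; last 5 first.
  - exact: mD.
  - by move=> xi _; rewrite lee_fin expR_ge0.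
  - by apply/measurable_EFinP; apply: measurable_funTS; exact: measurable_expRN.
  - by move=> xi _; rewrite mule_ge0// lee_fin ltW.
  - by apply: emeasurable_funM.
  rewrite integral_expRN// ge0_integralZl; last 4 first.
  - exact: mD.
  - exact: mI.
  - by move=> xi _; rewrite lee_fin.
  - by rewrite lee_fin ltW.
  rewrite integral_indic// setIidl; last first.
    by move=> x; rewrite /D/= !in_itv/= andbT => /andP[].
  have LI : lebesgue_measure (`[0, t^-1]%classic : set R) = (t^-1)%:E.
    by rewrite lebesgue_measure_itv/= lte_fin invr_gt0 t0 -EFinB subr0.
  by rewrite [X in (_ + _ * X)%E]LI -EFinM -EFinD.
have I2 : (\int[lebesgue_measure]_(xi in D)
    (expR (- (s * xi)) *
       (1 + cos (xi * a) * expR (- (t * (gamma * `|xi| `^ alpha)))) +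
     b * expR (- (r * xi)))%:E = (s^-1)%:E + J + (b / r)%:E)%E.
  under eq_integral do rewrite EFinD.
  have mE : measurable_fun D (fun xi : R => (expR (- (r * xi)))%:E).
    by apply/measurable_EFinP; apply: measurable_funTS; exact: measurable_expRN.
  rewrite ge0_integralD; last 5 first.
  - exact: mD.
  - by move=> xi _; rewrite lee_fin stable_charfun_ge0// ltW.
  - apply/measurable_EFinP; apply: measurable_funTS.
    exact: measurable_stable_charfun.
  - by move=> xi _; rewrite lee_fin mulr_ge0 ?expR_ge0.
  - by under eq_fun do rewrite EFinM; exact: emeasurable_funM.
  rewrite IJ; congr (_ + _)%E.
  under eq_integral do rewrite EFinM.
  rewrite ge0_integralZl; last 4 first.
  - exact: mD.
  - exact: mE.
  - by move=> xi _; rewrite lee_fin expR_ge0.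
  - by rewrite lee_fin expR_ge0.
  by rewrite integral_expRN// EFinM.
have : ((s^-1 + A / t)%:E <= (s^-1)%:E + J + (b / r)%:E)%E.
  rewrite -I1 -I2; apply: le_integral_ge0 => xi; rewrite /D/= in_itv/= andbT => x0.
    by rewrite lee_fin addr_ge0 ?expR_ge0// mulr_ge0// ltW.
  rewrite lee_fin; apply: stable_poisson_pointwise => //.
  by rewrite /eta ler_pdivrMr// mul1r; apply: le_trans aM _; lra.
have br : b / r <= A / 2 / t.
  have b1 : b <= (t * kappa * eta / 2)^-1.
    by apply: expRN_le_inv; rewrite divr_gt0// (mulr_gt0 (mulr_gt0 t0 k0) e0).
  have : b / r <= (t * kappa * eta / 2)^-1 / r.
    by rewrite ler_wpM2r// invr_ge0 ltW.
  move=> /le_trans; apply.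
  have -> : (t * kappa * eta / 2)^-1 / r = (A / 2 / t) * (t1 / t).
    by rewrite /r /t1; field; rewrite !(gt_eqF e0, gt_eqF k0, gt_eqF t0, gt_eqF A0).
  rewrite -[leRHS]mulr1 ler_wpM2l//; last by rewrite ler_pdivrMr// mul1r.
  by rewrite !divr_ge0// ltW.
(* Nonnegativity excludes [J = -oo], the case [J = +oo] is immediate, and for finite [J] the common
   [s^-1] can be cancelled. *)
have : (0 <= J)%E.
  by apply: integral_ge0 => w _; rewrite lee_fin poisson_kernel_ge0.
case: J IJ I2 => [j| |] _ _ _; rewrite ?leey// -!EFinD !lee_fin.
have -> : A / t = A / 2 / t + A / 2 / t by field; rewrite gt_eqF.
by lra.
Qed.

Lemma integral_inv_itv (R : realType) (q a b : R) : 0 < a -> a < b ->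
  (\int[lebesgue_measure]_(t in `[a, b]%classic) (q / t)%:E)%E
    = (q * (ln b - ln a))%:E.
Proof.
move=> a0 ab; pose F (t : R) := q * ln t.
have dF t : a <= t <= b -> is_derive t 1 F (q / t).
  move=> /andP[at_ _]; have t0 : 0 < t by exact: lt_le_trans at_.
  have := is_derive1_ln t0 => dln.
  by apply: is_derive_eq.
rewrite (integral_FTC2 ab _ dF); first by congr EFin; rewrite /F; ring.
move=> t /andP[at_ _]; apply: cvgM; first exact: cvg_cst.
by apply: cvgV; [rewrite gt_eqF// (lt_le_trans a0)|exact: cvg_id].
Qed.

Lemma integral_ge_inv_pinfty (R : realType) (f : R -> \bar R) (q t0 : R) :
  0 < q -> 0 < t0 -> (forall t, 0 <= t -> (0 <= f t)%E) ->
  (forall t, t0 <= t -> ((q / t)%:E <= f t)%E) ->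
  (\int[lebesgue_measure]_(t in `[0%R, +oo[%classic) f t = +oo)%E.
Proof.
move=> q0 t00 f0 ft; apply/eqyP => A A0.
(* With this endpoint the integral of q / t over [t0, N] is q ln (N / t0), exactly [A]. *)
pose N := t0 * expR (A / q).
have tN : t0 < N by rewrite /N ltr_pMr// -expR0 ltr_expR divr_gt0.
have <- : (\int[lebesgue_measure]_(t in `[t0, N]%classic) (q / t)%:E)%E = A%:E.
  rewrite integral_inv_itv// /N lnM ?posrE ?expR_gt0// expRK addrAC subrr add0r.
  by rewrite mulrCA mulfV ?mulr1// gt_eqF.
have -> : (`[t0, N]%classic : set R) = (`[0, +oo[ `&` `[t0, N])%classic.
  rewrite setIidr// => t /=; rewrite !in_itv/= andbT => /andP[+ _].
  exact: le_trans (ltW t00).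
rewrite integral_mkcondr; apply: le_integral_ge0 => t /=; rewrite in_itv/= andbT.
- move=> t0'; rewrite /patch; case: ifP => // _.
  by rewrite lee_fin divr_ge0// ltW.
- move=> t0'; rewrite /patch; case: ifPn => [|_]; last exact: f0.
  by rewrite inE/= in_itv/= => /andP[? _]; exact: ft.
Qed.

Lemma stable_recurrent (d : measure_display) (T : measurableType d)
    (R : realType) (P : probability T R) (X : R -> {RV P >-> R})
    (alpha gamma : R) :
  1 <= alpha -> 0 < gamma ->
  has_characteristic_exponent X (fun xi : R => (gamma * (`|xi| `^ alpha))%:C) ->
  recurrent (levy_transition X).
Proof.
move=> a1 g0 hp.
(* Infinite occupation time is in particular positive, so irreducibility comes along. *)
suff infty (B : set R) : measurable B -> (0 < lebesgue_measure B)%E -> forall x : R,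
    (\int[lebesgue_measure]_(t in `[0%R, +oo[%classic)
       levy_transition X t x B = +oo)%E.
  by split => // B mB B0 x; rewrite infty// ltry.
(* Inner regularity yields a compact subset of [B] of positive measure. *)
move=> mB; rewrite lebesgue_regularity_inner_sup//.
move=> /ereal_sup_gt[_ [K [cK KB] <-]] K0 x.
have mK : measurable K.
  by apply: closed_measurable; exact: compact_closed (@Rhausdorff R) cK.
have [M [_ KM]] := compact_bounded cK.
pose m := fine (lebesgue_measure K).
have mE : lebesgue_measure K = m%:E.
  rewrite /m fineK// ge0_fin_numE; last exact: ltW.
  exact: compact_finite_measure.
have m0 : 0 < m by rewrite -lte_fin -mE.
(* [M'] bounds the shifts a = x - y for all y in [K], making the lower bound uniform over [K]. *)
pose M' : R := `|x| + (`|M| + 1).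
have M'0 : 0 <= M' by rewrite !addr_ge0.
have [c [t0 [c0 t00 H]]] := stable_poisson_lower_bound a1 g0 M'0 hp.
apply: (@integral_ge_inv_pinfty _ _ (c * m / pi) t0) => //.
- by rewrite divr_gt0 ?pi_gt0// mulr_gt0.
- by move=> t _; exact: (measure_ge0 P).
- move=> t t0t; rewrite /levy_transition /pushforward.
  have t_gt0 : 0 < t by exact: lt_le_trans t0t.
  have mY : measurable_fun setT (fun w => x + X t w) by exact: measurable_funD.
  apply: (@le_trans _ _ (P ((fun w => x + X t w) @^-1` K)%classic)); last first.
    apply: le_measure; rewrite ?inE.
    - by rewrite -[X in measurable X]setTI; exact: mY.
    - by rewrite -[X in measurable X]setTI; exact: mY.
    - by move=> w /= /KB.
  have : ((c / t)%:E * m%:E <=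
      pi%:E * P ((fun w => (x + X t w)%R) @^-1` K)%classic)%E.
    rewrite -mE; apply: poisson_lower_bound_compact => //.
      by rewrite divr_ge0// ltW.
    move=> s y s0 s1 Ky; under eq_integral do rewrite addrAC.
    apply: H => //; rewrite (le_trans (ler_normB _ _))// lerD2l.
    by apply: (KM (`|M| + 1)) => //; have := ler_norm M; lra.
  have mYK : measurable ((fun w => x + X t w) @^-1` K)%classic.
    by rewrite -[X in measurable X]setTI; exact: mY.
  set p := P _; have : p \is a fin_num by exact: fin_num_measure.
  case: p => // p _; rewrite -!EFinM !lee_fin => cp.
  have -> : c * m / pi / t = c / t * m / pi by ring.
  by rewrite ler_pdivrMr ?pi_gt0// [leRHS]mulrC.
Qed.

(** * Transience *)

Lemma cvg_powRy (R : realType) (e : R) : 0 < e ->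
  ((1 + t) `^ e @[t --> +oo] --> +oo)%classic.
Proof.
move=> e0; apply/cvgryPge => A; near=> t.
(* The threshold comes from u ^ e = e ^ (e ln u) >= 1 + e ln u, which exceeds [A] once ln u >= A /
   e. *)
have tA : expR (A / e) <= t by near: t; exact: nbhs_pinfty_ge.
have t0 : 0 < t by exact: lt_le_trans (expR_gt0 _) tA.
rewrite /powR gt_eqF ?addr_gt0//; apply: le_trans (expR_ge1Dx _).
have : A / e <= ln (1 + t).
  by rewrite -[leLHS]expRK ler_ln ?posrE ?expR_gt0 ?addr_gt0// (le_trans tA)// lerDr.
by rewrite ler_pdivrMr// => /le_trans; apply; rewrite [leLHS]mulrC lerDr.
Unshelve. all: by end_near. Qed.

Lemma integral_powRN_lty (R : realType) (D k : R) : 0 <= D -> 1 < k ->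
  (\int[lebesgue_measure]_(t in `[0%R, +oo[%classic) (D * (1 + t) `^ (- k))%:E
    < +oo)%E.
Proof.
move=> D0 k1; pose F (t : R) := (D / (1 - k)) * (1 + t) `^ (1 - k).
have k1n : 1 - k != 0 by rewrite lt_eqF// subr_lt0.
have dF (t : R) : 0 <= t -> is_derive t 1 F (D * (1 + t) `^ (- k)).
  move=> t0; have u0 : 0 < 1 + t by lra.
  have dp := is_derive1_powR (1 - k) u0.
  have dg : is_derive t 1 (fun t : R => 1 + t) 1.
    by apply: is_derive_eq; rewrite add0r mulr1.
  have dc := is_derive1_comp dp dg.
  apply: is_derive_eq.
  rewrite /GRing.scale/= addrAC subrr add0r; field.
  by rewrite k1n.
rewrite (@integral_FTC2y _ _ _ _ 0 _ _ dF) ?ltry//.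
- by move=> t _; rewrite mulr_ge0// powR_ge0.
- move=> t t0; apply: differentiable_continuous; apply/derivable1_diffP.
  have u0 : 0 < 1 + t by lra.
  have dp := is_derive1_powR (- k) u0.
  have dg : is_derive t 1 (fun t : R => 1 + t) 1.
    by apply: is_derive_eq; rewrite add0r mulr1.
  have dc := is_derive1_comp dp dg.
  exact: ex_derive.
- have e0 : 0 < k - 1 by lra.
  have : ((1 + t) `^ (1 - k) @[t --> +oo] --> (0 : R))%classic.
    under eq_fun do rewrite -opprB powRN.
    apply/gtr0_cvgV0; last exact: cvg_powRy.
    by near=> t; rewrite powR_gt0// ltr_wpDr//; near: t; exact: nbhs_pinfty_ge.
  by move=> /(cvgMl_tmp (a := D / (1 - k))); rewrite mulr0; apply.
Unshelve. all: by end_near. Qed.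

(** On [-1, 1] the kernel of scale 1 is at least 1 / 2, so the probability is at most twice its
    expectation, the integral of e ^ (- xi) e ^ (- t gamma xi ^ alpha). The part below [delta]
    contributes at most [delta], and beyond it the second factor is at most its value at [delta]. *)
Lemma stable_small_ball (d : measure_display) (T : measurableType d)
    (R : realType) (P : probability T R) (X : R -> {RV P >-> R})
    (alpha gamma t delta : R) :
  0 < alpha -> 0 < gamma -> 0 <= t -> 0 < delta ->
  has_characteristic_exponent X (fun xi : R => (gamma * (`|xi| `^ alpha))%:C) ->
  (P (X t @^-1` `[(- 1)%R, 1%R])%classic <=
    (2 * (delta + expR (- (t * (gamma * delta `^ alpha)))))%:E)%E.
Proof.
move=> a0 g0 t0 d0 hp.
have mX : measurable_fun setT (X t) by [].
have mY : measurable_fun setT (fun w => 0 + X t w) by exact: measurable_funD.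
have hphi xi : 0 <= xi -> (\int[P]_w (cos (xi * (0 + X t w)))%:E =
    (cos (xi * 0) * expR (- (t * (gamma * `|xi| `^ alpha))))%:E)%E.
  by move=> _; rewrite (expectation_cos_shift _ _ hp).
have := expectation_poisson_kernel ltr01 mY hphi.
set J := (\int[P]_w _)%E => IJ.
pose D : set R := `[0, +oo[%classic.
have mD : measurable D by exact: measurable_itv.
pose b : R := expR (- (t * (gamma * delta `^ alpha))).
(* The integrand majorizes e ^ (- xi) (1 + e ^ (- t gamma xi ^ alpha)); the 1 in its total mass
   matches [s^-1] at s = 1. *)
have I1 : (\int[lebesgue_measure]_(xi in D)
    ((1 + b) * expR (- (1 * xi)) + \1_(`[0%R, delta]%classic) xi)%:E =
    (1 + b + delta)%:E)%E.
  under eq_integral do rewrite EFinD EFinM.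
  have mI : measurable_fun D (EFin \o (\1_(`[0, delta]%classic) : R -> R)).
    by apply/measurable_EFinP; apply: measurable_indic; exact: measurable_itv.
  have mE : measurable_fun D (fun xi : R => (expR (- (1 * xi)))%:E).
    by apply/measurable_EFinP; apply: measurable_funTS; exact: measurable_expRN.
  have b0 : 0 <= 1 + b by rewrite addr_ge0// expR_ge0.
  rewrite ge0_integralD; last 5 first.
  - exact: mD.
  - by move=> xi _; rewrite mule_ge0// lee_fin ?expR_ge0.
  - by apply: emeasurable_funM.
  - by move=> xi _; rewrite lee_fin.
  - exact: mI.
  rewrite ge0_integralZl; last 4 first.
  - exact: mD.
  - exact: mE.
  - by move=> xi _; rewrite lee_fin expR_ge0.
  - by rewrite lee_fin.
  rewrite integral_expRN// integral_indic// setIidl; last first.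
    by move=> x; rewrite /D/= !in_itv/= andbT => /andP[].
  have LI : lebesgue_measure (`[0, delta]%classic : set R) = delta%:E.
    by rewrite lebesgue_measure_itv/= lte_fin d0 -EFinB subr0.
  by rewrite [X in (_ + X)%E]LI -EFinM -EFinD invr1 mulr1.
have JE : (J <= (delta + b)%:E)%E.
  have : ((1^-1 : R)%:E + J <= (1 + b + delta)%:E)%E.
    rewrite IJ -I1; apply: le_integral_ge0 => xi; rewrite /D/= in_itv/= andbT => x0.
      by rewrite lee_fin stable_charfun_ge0// ltW.
    rewrite lee_fin mulr0 cos0 mul1r mulrC (ger0_norm x0).
    rewrite indicE; case: (boolP (xi \in _)) => [_|].
      rewrite !mulrDl mul1r -addrA lerD2l; apply: ler_wpDl.
        by rewrite mulr_ge0 ?expR_ge0.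
      rewrite mulr_ile1 ?expR_ge0// -expR0 ler_expR oppr_le0 ?mulr_ge0//.
        exact: ltW.
      exact: powR_ge0.
    rewrite addr0 => /negP; rewrite inE/= in_itv/= x0/= => /negP.
    rewrite -ltNge => dx.
    apply: ler_wpM2r; first exact: expR_ge0.
    rewrite lerD2l /b ler_expR lerN2 ler_wpM2l// ler_wpM2l ?(ltW g0)//.
    by rewrite ge0_ler_powR ?nnegrE ?(ltW a0) ?(ltW d0) ?(ltW dx).
  case: J {IJ} => [j| |]; rewrite ?leNye//.
  by rewrite -EFinD !lee_fin invr1; lra.
have mB : measurable (X t @^-1` `[(- 1)%R, 1%R])%classic.
  by rewrite -[X in measurable X]setTI; apply: mX => //; exact: measurable_itv.
apply: (@le_trans _ _ (2%:E * J)%E); last first.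
  by rewrite EFinM lee_wpmul2l.
rewrite /J -ge0_integralZl//; last 2 first.
- apply/measurable_EFinP.
  exact: measurableT_comp (measurable_poisson_kernel ltr01) mY.
- by move=> w _; rewrite lee_fin poisson_kernel_ge0.
have -> : (P (X t @^-1` `[(- 1)%R, 1%R])%classic =
    \int[P]_w (\1_(X t @^-1` `[(- 1)%R, 1%R])%classic w)%:E)%E.
  by rewrite integral_indic// setIT.
apply: le_integral_ge0 => w _; first by rewrite lee_fin.
rewrite -EFinM lee_fin indicE; case: (boolP (w \in _)) => [|_]; last first.
  by rewrite mulr_ge0// poisson_kernel_ge0.
rewrite inE/= in_itv/= add0r -ler_norml => w1.
have : X t w ^+ 2 <= 1 by rewrite -real_normK ?num_real// expr_le1.
move=> x1; rewrite mulrA mulr1 ler_pdivlMr ?mul1r ?expr1n//; first lra.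
by rewrite ltr_wpDr ?sqr_ge0.
Qed.

(** One term of the exponential series suffices: e ^ x >= x ^ m / m! at x = c u ^ a, with m so large
    that a m >= k. Then u ^ (a m) >= u ^ k because u >= 1. *)
Lemma expRN_le_powRN (R : realType) (c a k : R) : 0 < c -> 0 < a -> 0 <= k ->
  exists2 C : R, 0 <= C &
    forall u : R, 1 <= u -> expR (- (c * u `^ a)) <= C * u `^ (- k).
Proof.
move=> c0 a0 k0; pose n := Num.Def.archi_bound (k / a).
have kn : k <= a * n.+1%:R.
  rewrite mulrC -ler_pdivrMr//; apply: ltW.
  apply: (@lt_trans _ _ n%:R); last by rewrite ltr_nat.
  by rewrite /n archi_boundP// divr_ge0// ltW.
exists ((n.+1)`!%:R / c ^+ n.+1) => [|u u1].
  by rewrite divr_ge0// exprn_ge0// ltW.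
have u0 : 0 < u by exact: lt_le_trans u1.
have ua : 0 < c * u `^ a by rewrite mulr_gt0// powR_gt0.
have uk : 0 < u `^ k by rewrite powR_gt0.
have cn : 0 < c ^+ n.+1 by rewrite exprn_gt0.
have le1 : c ^+ n.+1 * u `^ k / (n.+1)`!%:R <= expR (c * u `^ a).
  apply: le_trans (expR_ge1Dxn n (ltW ua)); apply: ler_wpDl => //.
  rewrite ler_wpM2r ?invr_ge0// exprMn ler_wpM2l ?(ltW cn)//.
  by rewrite -powR_mulrn ?powR_ge0// -powRrM ler_powR.
rewrite expRN powRN -mulrA -invfM -[leRHS]invrK lef_pV2 ?posrE ?expR_gt0//.
  by rewrite invf_div.
rewrite invr_gt0; apply: divr_gt0; last exact: mulr_gt0.
by rewrite ltr0n fact_gt0.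
Qed.

Lemma stable_transient (d : measure_display) (T : measurableType d)
    (R : realType) (P : probability T R) (X : R -> {RV P >-> R})
    (alpha gamma : R) :
  0 < alpha -> alpha < 1 -> 0 < gamma ->
  has_characteristic_exponent X (fun xi : R => (gamma * (`|xi| `^ alpha))%:C) ->
  (\int[lebesgue_measure]_(t in `[0%R, +oo[%classic)
     levy_transition X t 0 `[(- 1)%R, 1%R]%classic < +oo)%E.
Proof.
move=> a0 a1 g0 hp.
(* The midpoint of 1 and 1 / alpha: k > 1 makes (1 + t) ^ (- k) integrable, and k alpha < 1 lets t
   (1 + t) ^ (- k alpha) still grow like a positive power. *)
pose k := (1 + alpha^-1) / 2.
have ia1 : 1 < alpha^-1 by rewrite invf_gt1.
have k1 : 1 < k by rewrite /k; lra.
have k0 : 0 <= k by lra.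
have ka : k * alpha = (1 + alpha) / 2.
  by rewrite /k; field; rewrite gt_eqF.
pose a := 1 - k * alpha.
have a_gt0 : 0 < a by rewrite /a ka; lra.
have g20 : 0 < gamma / 2 by rewrite divr_gt0.
have [C C0 HC] := expRN_le_powRN g20 a_gt0 k0.
(* The first summand serves t >= 1. The second serves t < 1, where the probability is at most 1 and
   1 + t <= 2. *)
pose D := 2 * (1 + C) + 2 `^ k.
have D0 : 0 <= D by rewrite addr_ge0 ?powR_ge0// mulr_ge0// addr_ge0.
apply: le_lt_trans (integral_powRN_lty D0 k1).
apply: le_integral_ge0 => t /=; rewrite in_itv/= andbT => t0.
  exact: (measure_ge0 P).
have u0 : 0 < 1 + t by lra.
have uk : 0 < (1 + t) `^ (- k) by rewrite powR_gt0.
have -> : levy_transition X t 0 `[(- 1)%R, 1%R]%classic =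
    P (X t @^-1` `[(- 1)%R, 1%R])%classic.
  rewrite /levy_transition /pushforward; congr (P _).
  by apply/seteqP; split => w /=; rewrite add0r.
have [t1|t1] := ltP t 1.
  apply: (@le_trans _ _ 1%E).
    apply: probability_le1; rewrite -[X in measurable X]setTI.
    by apply: measurable_funPT => //; exact: measurable_itv.
  rewrite lee_fin /D mulrDl; apply: ler_wpDl.
    by rewrite mulr_ge0 ?(ltW uk)// mulr_ge0// addr_ge0.
  rewrite powRN ler_pdivlMr ?powR_gt0// mul1r ge0_ler_powR ?nnegrE ?(ltW u0)//.
  by lra.
(* Passing [uk] selects the splitting point delta = (1 + t) ^ (- k). *)
apply: le_trans (stable_small_ball a0 g0 t0 uk hp) _.
rewrite lee_fin /D [leRHS]mulrDl; apply: ler_wpDr.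
  by rewrite mulr_ge0 ?powR_ge0.
rewrite -mulrA ler_wpM2l// [leRHS]mulrDl mul1r lerD2l.
have u1 : 1 <= 1 + t by lra.
(* As t >= (1 + t) / 2 for t >= 1, the exponent is at least (gamma / 2) (1 + t) ^ a, whence the
   constant [gamma / 2] in [HC]. *)
apply: le_trans (HC _ u1); rewrite ler_expR lerN2.
rewrite -powRrM mulNr /a powRD; last by rewrite (gt_eqF u0) implybT.
rewrite powRr1 ?(ltW u0)//.
have : 0 < (1 + t) `^ (- (k * alpha)) by rewrite powR_gt0.
set v := _ `^ _ => v0.
have -> : t * (gamma * v) = gamma * v * t by ring.
have -> : gamma / 2 * ((1 + t) * v) = gamma * v * ((1 + t) / 2) by ring.
by rewrite ler_wpM2l ?mulr_ge0 ?(ltW g0) ?(ltW v0)//; lra.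
Qed.

(** * Recurrence against transience, according to [alpha] *)

Unset Implicit Arguments.

Theorem corollary1p3 (R : realType) (d : measure_display)
    (T : measurableType d) (P : probability T R) (X : R -> {RV P >-> R})
    (alpha gamma : R)
    (halpha0 : 0 < alpha) (halpha2 : alpha <= 2) (halpha1 : alpha <> 1)
    (hgamma : 0 < gamma)
    (hX : levy_process X)
    (hp : has_characteristic_exponent X
            (fun xi : R => (gamma * (`|xi| `^ alpha))%:C)) :
  recurrent (levy_transition X) <-> 1 < alpha.
Proof.
split=> [[_ recX]|/ltW a1]; last exact: (stable_recurrent a1 hgamma hp).
rewrite ltNge le_eqVlt; apply/negP => /predU1P[//|a1].
(* For alpha < 1 the interval [-1, 1], of measure 2, has finite occupation time from 0, against
   recurrence. *)
have := stable_transient halpha0 a1 hgamma hp.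
rewrite recX ?ltxx//.
rewrite lebesgue_measure_itv/= -[1%E]/(1%:E) lte_fin ifT; last lra.
by rewrite -EFinD lte_fin; lra.
Qed.
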